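(* Let $k$ be a field. Every countably generated $L$-algebra over $k$ can be embedded into a two-generated $L$-algebra over $k$.
   Context: An $L$-algebra over $k$ is a $k$-vector space $L$ with two bilinear operations $\prec,\succ:L\times L\to L$ satisfying $(x\succ y)\prec z=x\succ(y\prec z)$ for all $x,y,z\in L$. Homomorphisms are linear maps preserving both operations; an embedding is an injective homomorphism. An $L$-algebra is two-generated (countably generated) if it is generated as an $L$-algebra by two elements (by a countable set). *)

(* Defs.v *)
From HB Require Import structures.
From mathcomp Require Import all_boot all_order all_algebra sesquilinear.
From mathcomp Require Import boolp classical_sets functions cardinality.

Set Implicit Arguments.
Unset Strict Implicit.
Unset Printing Implicit Defensive.

Import GRing.Theory.
Local Open Scope classical_set_scope.
Local Open Scope ring_scope.

Reserved Notation "x \prec y" (at level 40, no associativity).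
Reserved Notation "x \succ y" (at level 40, no associativity).

(* L-algebras; unrelated to [lalgType], the (unital, associative) left
   algebras of MathComp. *)
HB.mixin Record Lmodule_isPrecSuccAlgebra (k : fieldType) L
    of GRing.Lmodule k L := {
  prec : {bilinear L -> L -> L};
  succ : {bilinear L -> L -> L};
  succ_precA : forall x y z : L, prec (succ x y) z = succ x (prec y z)
}.

#[short(type="precSuccAlgType")]
HB.structure Definition PrecSuccAlgebra (k : fieldType) :=
  {L of GRing.Lmodule k L & Lmodule_isPrecSuccAlgebra k L}.

Notation "x \prec y" := (prec x y) : ring_scope.
Notation "x \succ y" := (succ x y) : ring_scope.

Section LAlgebraTheory.
Context (k : fieldType).
Implicit Types L M : precSuccAlgType k.

Definition is_lsubalgebra L (A : set L) : Prop :=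
  [/\ A 0,
      forall (c : k) (x y : L), A x -> A y -> A (c *: x + y),
      forall x y : L, A x -> A y -> A (x \prec y)
    & forall x y : L, A x -> A y -> A (x \succ y)].

Definition lgenerates L (X : set L) : Prop :=
  smallest (@is_lsubalgebra L) X = [set: L].

Definition countably_generated L : Prop :=
  exists2 X : set L, countable X & lgenerates X.

Definition two_generated L : Prop :=
  exists a b : L, lgenerates [set a; b].

Definition is_lhom L M (f : {linear L -> M}) : Prop :=
  {morph f : x y / x \prec y} /\ {morph f : x y / x \succ y}.

Definition is_lembedding L M (f : {linear L -> M}) : Prop :=
  is_lhom f /\ injective f.

End LAlgebraTheory.

(* Main.v *)
Require Import Defs.
From HB Require Import structures.
From mathcomp Require Import all_boot all_order all_algebra sesquilinear.
From mathcomp Require Import boolp classical_sets functions cardinality.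

(** Write [l_u y = u \succ y] and [r_z y = y \prec z].  The axiom of an
    L-algebra says exactly that every [l_u] commutes with every [r_z]; the two
    products are otherwise unrelated.  So an algebra can be enlarged by new
    elements [u] with [r_u = 0] and with any [l_u] that commutes with the right
    multiplications by the old elements.

    Let the sequence [s] run through generators of [L], and let [r_z] act
    termwise on the space of sequences [nat -> L].  The shift of sequences and
    the evaluation of a sequence at 0 both commute with the termwise [r_z],
    because they only move terms around.  So one may adjoin to [L] all
    sequences, an element [a] whose [l_a] is the shift, and an element [t]
    whose [l_t] is the evaluation at 0, with value in [L]: this is [seq_ext].
    Put [b = s + t].  Then
      [b \succ (a \succ (a \succ ... (a \succ b))) = s n]
    where [a] occurs [n] times, so [a] and [b] generate a subalgebra that
    contains [L] ([generated_seq_ext]).  This subalgebra ([gen_alg]) is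
    two-generated and [L] embeds into it. *)

Set Implicit Arguments.
Unset Strict Implicit.
Unset Printing Implicit Defensive.

Import GRing.Theory.
Local Open Scope classical_set_scope.
Local Open Scope ring_scope.

(** * Generated subalgebras *)

Section Generated.
Context (k : fieldType) (M : precSuccAlgType k).

Lemma smallest_is_lsubalgebra (X : set M) :
  is_lsubalgebra (smallest (@is_lsubalgebra k M) X).
Proof.
split.
- by move=> A [[]].
- by move=> c x y xG yG A AX; case: (AX.1) => _ h _ _; apply: h;
    [exact: xG|exact: yG].
- by move=> x y xG yG A AX; case: (AX.1) => _ _ h _; apply: h;
    [exact: xG|exact: yG].
- by move=> x y xG yG A AX; case: (AX.1) => _ _ _ h; apply: h;
    [exact: xG|exact: yG].
Qed.

Lemma preimage_is_lsubalgebra (L : precSuccAlgType k) (f : {linear L -> M})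
    (A : set M) :
  is_lhom f -> is_lsubalgebra A -> is_lsubalgebra (f @^-1` A).
Proof.
move=> [fp fs] [A0 Al Ap As]; split=> /=.
- by rewrite linear0.
- by move=> c x y Ax Ay; rewrite linearP; exact: Al.
- by move=> x y Ax Ay; rewrite fp; exact: Ap.
- by move=> x y Ax Ay; rewrite fs; exact: As.
Qed.

Lemma image_is_lsubalgebra (L : precSuccAlgType k) (f : {linear L -> M})
    (A : set L) :
  is_lhom f -> is_lsubalgebra A -> is_lsubalgebra (f @` A).
Proof.
move=> [fp fs] [A0 Al Ap As]; split.
- by exists 0; rewrite ?linear0.
- move=> c _ _ [x Ax <-] [y Ay <-].
  by exists (c *: x + y); rewrite ?linearP; [exact: Al|].
- move=> _ _ [x Ax <-] [y Ay <-].
  by exists (x \prec y); rewrite ?fp; [exact: Ap|].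
- move=> _ _ [x Ax <-] [y Ay <-].
  by exists (x \succ y); rewrite ?fs; [exact: As|].
Qed.

(** A type carrying the subalgebra generated by [X].  Generation is part of
    the type, so its closure properties hold for every [X] and the algebra
    structure can be inferred. *)
Definition gen_alg (X : set M) : Type :=
  {x : M | x \in smallest (@is_lsubalgebra k M) X}.

End Generated.

Section GenAlg.
Context (k : fieldType) (M : precSuccAlgType k) (X : set M).
Local Notation G := (smallest (@is_lsubalgebra k M) X).
Local Notation S := (gen_alg X).

HB.instance Definition _ := [isSub for (@sval M (fun x => x \in G)) : S -> M].
HB.instance Definition _ := [Choice of S by <:].

Lemma gen_alg_subsemimod_closed : subsemimod_closed (fun x : M => x \in G).
Proof.
have [G0 Gl _ _] := smallest_is_lsubalgebra X.
split; first split.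
- exact/mem_set.
- by move=> x y /set_mem Gx /set_mem Gy; apply/mem_set;
    rewrite -[x]scale1r; exact: Gl.
- by move=> c x /set_mem Gx; apply/mem_set; rewrite -[_ *: _]addr0; exact: Gl.
Qed.

HB.instance Definition _ :=
  GRing.SubChoice_isSubLmodule.Build k M _ S gen_alg_subsemimod_closed.

Lemma gen_alg_valP (x : S) : G (val x).
Proof. exact/set_mem/(valP x). Qed.

Lemma gen_alg_prec_closed (x y : S) : val x \prec val y \in G.
Proof.
have [_ _ h _] := smallest_is_lsubalgebra X.
by apply/mem_set; apply: h; exact: gen_alg_valP.
Qed.

Lemma gen_alg_succ_closed (x y : S) : val x \succ val y \in G.
Proof.
have [_ _ _ h] := smallest_is_lsubalgebra X.
by apply/mem_set; apply: h; exact: gen_alg_valP.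
Qed.

Definition gen_prec (x y : S) : S :=
  Sub (val x \prec val y) (gen_alg_prec_closed x y).
Definition gen_succ (x y : S) : S :=
  Sub (val x \succ val y) (gen_alg_succ_closed x y).

Lemma gen_prec_bilinear : bilinear_for *:%R *:%R gen_prec.
Proof.
by split=> z c x y; apply: val_inj => /=;
  [exact: linearPl|exact: linearPr].
Qed.

Lemma gen_succ_bilinear : bilinear_for *:%R *:%R gen_succ.
Proof.
by split=> z c x y; apply: val_inj => /=;
  [exact: linearPl|exact: linearPr].
Qed.

HB.instance Definition _ :=
  bilinear_isBilinear.Build k S S S *:%R *:%R gen_prec gen_prec_bilinear.
HB.instance Definition _ :=
  bilinear_isBilinear.Build k S S S *:%R *:%R gen_succ gen_succ_bilinear.

Lemma gen_succ_precA (x y z : S) :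
  gen_prec (gen_succ x y) z = gen_succ x (gen_prec y z).
Proof. by apply: val_inj; exact: succ_precA. Qed.

HB.instance Definition _ :=
  Lmodule_isPrecSuccAlgebra.Build k S gen_succ_precA.

Lemma gen_alg_val_is_lhom : is_lhom (val : {linear S -> M}).
Proof. by split. Qed.

(** Being generated by [X] inside [M] and being generated by [X] as an algebra
    on its own agree: the image in [M] of a subalgebra of [gen_alg X] is a
    subalgebra of [M], so it contains all of the generated subalgebra as soon
    as it contains [X]. *)
Lemma lgenerates_gen_alg : lgenerates ((val : S -> M) @^-1` X).
Proof.
apply/seteqP; split=> // x _ A [Asub XA].
have GA : G `<=` (val : {linear S -> M}) @` A.
  apply: smallest_sub.
    exact: image_is_lsubalgebra gen_alg_val_is_lhom Asub.
  move=> y Xy; have Gy : y \in G by apply/mem_set; exact: sub_gen_smallest.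
  by exists (Sub y Gy : S) => //; exact: XA.
by have [y Ay /val_inj <-] := GA _ (gen_alg_valP x).
Qed.

End GenAlg.

Lemma lembedding_gen_alg (k : fieldType) (L M : precSuccAlgType k) (X : set M)
    (f : {linear L -> M}) :
  is_lembedding f ->
  range f `<=` smallest (@is_lsubalgebra k M) X ->
  exists g : {linear L -> gen_alg X}, is_lembedding g.
Proof.
move=> [[fp fs] f_inj] fG.
have fG' x : f x \in smallest (@is_lsubalgebra k M) X.
  by apply/mem_set; apply: fG; exists x.
pose g x : gen_alg X := Sub (f x) (fG' x).
have g_lin : linear g by move=> c x y; apply: val_inj; rewrite /= !linearP.
pose gL : {linear L -> gen_alg X} :=
  HB.pack g (GRing.isLinear.Build _ _ _ _ g g_lin).
exists gL; split; first split.
- by move=> x y; apply: val_inj; exact: fp.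
- by move=> x y; apply: val_inj; exact: fs.
- by move=> x y /(congr1 val); exact: f_inj.
Qed.

(** * Adjoining sequences, a shift and an evaluation *)

(** The last two components are the coefficients of the adjoined elements that
    act as the shift and as the evaluation at 0, in this order. *)
Definition seq_ext (k : fieldType) (L : precSuccAlgType k) : Type :=
  (L * (nat -> L) * (k^o * k^o))%type.

Section SeqExt.
Context (k : fieldType) (L : precSuccAlgType k).
Local Notation M := (seq_ext L).
Implicit Types (u v w : M) (s : nat -> L).

HB.instance Definition _ := GRing.Lmodule.on M.

(** Only the [L]-part acts on the right, and it acts termwise on sequences. *)
Definition ext_prec u v : M :=
  (u.1.1 \prec v.1.1, fun n => u.1.2 n \prec v.1.1, 0).

(** The two operators act on sequences only.  The [L]-part acts on the left on
    [L] alone, so that no condition relates it to sequences. *)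
Definition ext_succ u v : M :=
  (u.1.1 \succ v.1.1 + (u.2.2 : k) *: v.1.2 0%N,
   fun n => (u.2.1 : k) *: v.1.2 n.+1,
   0).

Lemma seq_extP u v : u.1.1 = v.1.1 -> u.1.2 =1 v.1.2 -> u.2 = v.2 -> u = v.
Proof.
by case: u v => [[x s] p] [[y t] q] /= -> /funext -> ->.
Qed.

Lemma ext_prec_bilinear : bilinear_for *:%R *:%R ext_prec.
Proof.
split=> z c x y; apply: seq_extP => [|n|] /=.
- exact: linearPl.
- exact: linearPl.
- by rewrite scaler0 addr0.
- exact: linearPr.
- exact: linearPr.
- by rewrite scaler0 addr0.
Qed.

Lemma ext_succ_bilinear : bilinear_for *:%R *:%R ext_succ.
Proof.
split=> z c x y; apply: seq_extP => [|n|] /=.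
- by rewrite linearPl scalerDl -scalerA scalerDr addrACA.
- by rewrite scalerDl -scalerA.
- by rewrite scaler0 addr0.
- rewrite linearPr scalerDr addrACA [in RHS]scalerDr; congr (_ + _ + _).
  by rewrite [LHS]scalerA mulrC -scalerA.
- by rewrite [LHS]scalerDr [X in X + _]scalerA mulrC -scalerA.
- by rewrite scaler0 addr0.
Qed.

HB.instance Definition _ :=
  bilinear_isBilinear.Build k M M M *:%R *:%R ext_prec ext_prec_bilinear.
HB.instance Definition _ :=
  bilinear_isBilinear.Build k M M M *:%R *:%R ext_succ ext_succ_bilinear.

(** Besides the axiom in [L], this is the fact that evaluation and shift
    commute with termwise right multiplication. *)
Lemma ext_succ_precA u v w :
  ext_prec (ext_succ u v) w = ext_succ u (ext_prec v w).
Proof.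
apply: seq_extP => [|n|] //=.
- by rewrite linearDl linearZl_LR succ_precA.
- by rewrite linearZl_LR.
Qed.

HB.instance Definition _ := Lmodule_isPrecSuccAlgebra.Build k M ext_succ_precA.

Definition ext_inj (x : L) : M := (x, 0, 0).

Lemma ext_inj_linear : linear ext_inj.
Proof.
move=> c x y; apply: seq_extP => [|n|] //=.
- by rewrite [RHS]addr0 [RHS]scaler0.
- by rewrite scaler0 addr0.
Qed.

HB.instance Definition _ := GRing.isLinear.Build _ _ _ _ ext_inj ext_inj_linear.

Lemma ext_inj_lembedding : is_lembedding (ext_inj : {linear L -> M}).
Proof.
split; first split.
- move=> x y; apply: seq_extP => [|n|] //=.
  by rewrite linear0l.
- move=> x y; apply: seq_extP => [|n|] /=.
  + by rewrite scaler0 addr0.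
  + by rewrite scale0r.
  + by [].
- by move=> x y [].
Qed.

Definition shift_elt : M := (0, 0, (1, 0)).

(** The second generator is at once the sequence [s] and the operator that
    evaluates sequences at 0; merging the two roles is what brings the number
    of generators down from three to two. *)
Definition seq_elt s : M := (0, s, (0, 1)).

(** Shifting [n] times and then evaluating at 0 reads off the term [s n].  The
    elements of [L] that the two elements generate form a subalgebra of
    [L], hence everything. *)
Lemma generated_seq_ext s :
  lgenerates (range s) ->
  range ext_inj `<=`
    smallest (@is_lsubalgebra k M) [set shift_elt; seq_elt s].
Proof.
set G := smallest _ _ => s_gen.
have Gsub : is_lsubalgebra G by exact: smallest_is_lsubalgebra.
have [_ _ _ Gs] := Gsub.
have Ga : G shift_elt by apply: sub_gen_smallest; left.
have Gb : G (seq_elt s) by apply: sub_gen_smallest; right.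
(* For [n > 0] this is the pure sequence [s] shifted [n] times; for [n = 0] it
   still has the evaluation as a component, which left multiplication by
   [seq_elt s] ignores. *)
pose tail n : M := iter n (succ shift_elt) (seq_elt s).
have Gtail n : G (tail n) by elim: n => //= n IHn; exact: Gs.
have tailE n m : (tail n).1.2 m = s (n + m)%N.
  elim: n m => //= n IHn m.
  by rewrite scale1r IHn addnS.
have Gsn n : G (ext_inj (s n)).
  have -> : ext_inj (s n) = seq_elt s \succ tail n.
    apply: seq_extP => [|m|] //=.
    + by rewrite linear0l add0r scale1r tailE addn0.
    + by rewrite scale0r.
  exact: Gs.
have Gpre : is_lsubalgebra (ext_inj @^-1` G).
  exact: preimage_is_lsubalgebra ext_inj_lembedding.1 Gsub.
have sub : [set: L] `<=` ext_inj @^-1` G.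
  by rewrite -s_gen; apply: smallest_sub => // _ [n _ <-]; exact: Gsn.
by move=> _ [x _ <-]; exact: sub.
Qed.

End SeqExt.

Lemma countably_generated_seq (k : fieldType) (L : precSuccAlgType k) :
  countably_generated L -> exists s : nat -> L, lgenerates (range s).
Proof.
move=> [X /countable_injP[r r_inj] X_gen].
(* Indices that [r] does not reach get the default value 0; enlarging a
   generating set keeps it generating. *)
pose s n := xget 0 [set x | X x /\ r x = n].
have Xs : X `<=` range s.
  move=> x Xx; exists (r x) => //.
  have [Xs rs] : [set y | X y /\ r y = r x] (s (r x)).
    by apply: xgetPex; exists x.
  by apply: r_inj; rewrite ?inE.
exists s; apply/seteqP; split=> //; rewrite -X_gen.
apply: smallest_sub; first exact: smallest_is_lsubalgebra.
by apply: subset_trans Xs _; exact: sub_gen_smallest.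
Qed.

Theorem theorem5p8 (k : fieldType) (L : precSuccAlgType k) :
  countably_generated L ->
  exists (M : precSuccAlgType k) (f : {linear L -> M}),
    is_lembedding f /\ two_generated M.
Proof.
move=> /countably_generated_seq[s s_gen].
pose a : seq_ext L := shift_elt L; pose b := seq_elt s.
have [f f_emb] :=
  lembedding_gen_alg (ext_inj_lembedding L) (generated_seq_ext s_gen).
exists (gen_alg [set a; b]), f; split=> //.
have Ga : a \in smallest (@is_lsubalgebra k _) [set a; b].
  by apply/mem_set; apply: sub_gen_smallest; left.
have Gb : b \in smallest (@is_lsubalgebra k _) [set a; b].
  by apply/mem_set; apply: sub_gen_smallest; right.
pose a' : gen_alg [set a; b] := Sub a Ga.
pose b' : gen_alg [set a; b] := Sub b Gb.
exists a', b'.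
have -> : [set a'; b'] = (val : gen_alg [set a; b] -> _) @^-1` [set a; b].
  apply/seteqP; split=> x; first by case=> ->; [left|right].
  by case=> xE; [left|right]; exact: val_inj.
exact: lgenerates_gen_alg.
Qed.
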